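(* Let $\Omega$ be a commutative semigroup and let $(A,( *_{\alpha,\beta})_{\alpha,\beta\in\Omega})$ be an $\Omega$-associative $H$-pseudoalgebra with $H^{2}_{\Omega}(A,A)=0$. Then $(A,( *_{\alpha,\beta})_{\alpha,\beta\in\Omega})$ is rigid.
   Context: $k$ is an algebraically closed field of characteristic zero and $H$ is a cocommutative Hopf algebra over $k$ with comultiplication $\Delta$; $\otimes=\otimes_k$. For $n\ge 1$, $H^{\otimes n}$ is a right $H$-module via the iterated comultiplication, and for a left $H$-module $M$ the space $H^{\otimes n}\otimes_H M$ is a left $H^{\otimes n}$-module by left multiplication. A linear map $\mu: L\otimes M\to H^{\otimes 2}\otimes_H N$ (with $L,M,N$ left $H$-modules) is $H^{\otimes 2}$-linear if $\mu(fa,gb)=((f\otimes g)\otimes_H 1)\mu(a,b)$ for all $f,g\in H$. Such maps are composed as follows: if $\mu(x,y)=\sum_i (f_i\otimes g_i)\otimes_H e_i$ and $F\in H^{\otimes 2}$, then $$\mu(F\otimes_H x,\,y)=\sum_i (F\otimes 1)(\Delta\otimes \mathrm{id})(f_i\otimes g_i)\otimes_H e_i,\qquad \mu(x,\,F\otimes_H y)=\sum_i (1\otimes F)(\mathrm{id}\otimes\Delta)(f_i\otimes g_i)\otimes_H e_i,$$ elements of $H^{\otimes 3}\otimes_H N$. An $H$-linear map $\phi:M\to N$ is applied to $H^{\otimes n}\otimes_H M$ as $\mathrm{id}\otimes_H\phi$. An $\Omega$-associative $H$-pseudoalgebra is a left $H$-module $A$ with $H^{\otimes 2}$-linear maps $*_{\alpha,\beta}:A\otimes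 A\to H^{\otimes 2}\otimes_H A$ ($\alpha,\beta\in\Omega$) such that $(a*_{\alpha,\beta}b)*_{\alpha\beta,\gamma}c=a*_{\alpha,\beta\gamma}(b*_{\beta,\gamma}c)$ for all $a,b,c\in A$, $\alpha,\beta,\gamma\in\Omega$. Cohomology with coefficients in $A$ (viewed as a bimodule over itself via $*_{\alpha,\beta}$), in degree 2: $C^1_\Omega(A,A)$ is the space of families $\phi=(\phi_\alpha)_{\alpha\in\Omega}$ of $H$-linear maps $\phi_\alpha:A\to A$ (identifying $H\otimes_H A=A$); $C^2_\Omega(A,A)$ is the space of families $f=(f_{\alpha,\beta})_{\alpha,\beta\in\Omega}$ of $H^{\otimes 2}$-linear maps $f_{\alpha,\beta}:A\otimes A\to H^{\otimes 2}\otimes_H A$. The differentials are $$(d^1_\Omega \phi)_{\alpha,\beta}(a,b)=a*_{\alpha,\beta}\phi_\beta(b)-\phi_{\alpha\beta}(a*_{\alpha,\beta}b)+\phi_\alpha(a)*_{\alpha,\beta}b,$$ $$(d^2_\Omega f)_{\alpha,\beta,\gamma}(a,b,c)=a*_{\alpha,\beta\gamma}f_{\beta,\gamma}(b,c)-f_{\alpha,\beta}(a,b)*_{\alpha\beta,\gamma}c-f_{\alpha\beta,\gamma}(a*_{\alpha,\beta}b,c)+f_{\alpha,\beta\gamma}(a,b*_{\beta,\gamma}c).$$ $H^2_\Omega(A,A)=\ker d^2_\Omega/\operatorname{im} d^1_\Omega$. A formal deformation of $A$ is a formal sum $\mathfrak{T}^{t}_{\alpha,\beta}=\sum_{i\ge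 0}T^{(i)}_{\alpha,\beta}t^i$ where each $T^{(i)}_{\alpha,\beta}:A\otimes A\to H^{\otimes 2}\otimes_H A$ is $H^{\otimes 2}$-linear, $T^{(0)}_{\alpha,\beta}(x,y)=x*_{\alpha,\beta}y$, and $\mathfrak{T}^{t}_{\alpha,\beta\gamma}(x,\mathfrak{T}^{t}_{\beta,\gamma}(y,z))=\mathfrak{T}^{t}_{\alpha\beta,\gamma}(\mathfrak{T}^{t}_{\alpha,\beta}(x,y),z)$ for all $x,y,z\in A$, $\alpha,\beta,\gamma\in\Omega$, i.e. for all $s\ge 0$, $\sum_{i=0}^{s}T^{(i)}_{\alpha,\beta\gamma}(x,T^{(s-i)}_{\beta,\gamma}(y,z))=\sum_{i=0}^{s}T^{(i)}_{\alpha\beta,\gamma}(T^{(s-i)}_{\alpha,\beta}(x,y),z)$. Two formal deformations $\mathfrak{T}^{t}$ and $\widetilde{\mathfrak{T}}^{t}$ of $A$ are equivalent if there is a family $(\Phi^t_\omega)_{\omega\in\Omega}$ with $\Phi^t_\omega=\sum_{i\ge 0}\phi^{(i)}_\omega t^i:A\to A[[t]]$, each $\phi^{(i)}_\omega:A\to A$ being $H$-linear and $\phi^{(0)}_\omega=\mathrm{id}$, such that $\Phi^t_{\alpha\beta}(\mathfrak{T}^t_{\alpha,\beta}(x,y))=\widetilde{\mathfrak{T}}^t_{\alpha,\beta}(\Phi^t_\alpha(x),\Phi^t_\beta(y))$ for all $x,y\in A$, $\alpha,\beta\in\Omega$, both sides being expanded as formal power series in $t$ and compared coefficientwise. $A$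 is rigid if every formal deformation $\mathfrak{T}^t_{\alpha,\beta}$ of $A$ is equivalent to the trivial deformation $\widetilde{\mathfrak{T}}^t_{\alpha,\beta}=T^{(0)}_{\alpha,\beta}$. *)

(* Defs.v *)
From HB Require Import structures.
From mathcomp Require Import all_boot all_order all_algebra.
From mathcomp Require Import boolp classical_sets functions.

Set Implicit Arguments.
Unset Strict Implicit.
Unset Printing Implicit Defensive.

Import GRing.Theory.

Local Open Scope ring_scope.
Local Open Scope quotient_scope.

(* V is a K-module on which the scalars R act on the right, K-linearly, by
   actr; R acts on the left of the abelian group W by actl. The tensor product
   is the group of formal sums of pairs (v, w), modulo the congruence generated
   by biadditivity and by (v . r, w) ~ (v, r . w); it is a K-module through V. *)

Section BalancedTensor.
Variables (K : pzRingType) (V : lmodType K) (W : zmodType) (R : Type).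
Variables (actr : R -> {linear V -> V}) (actl : R -> W -> W).

Inductive tcong : seq (V * W) -> seq (V * W) -> Prop :=
| tcong_refl s : tcong s s
| tcong_sym s t : tcong s t -> tcong t s
| tcong_trans s t u : tcong s t -> tcong t u -> tcong s u
| tcong_cat s s' t t' : tcong s s' -> tcong t t' -> tcong (s ++ t) (s' ++ t')
| tcong_comm s t : tcong (s ++ t) (t ++ s)
| tcong_opp v w : tcong [:: (v, w); (- v, w)] [::]
| tcong_addl v v' w : tcong [:: (v + v', w)] [:: (v, w); (v', w)]
| tcong_addr v w w' : tcong [:: (v, w + w')] [:: (v, w); (v, w')]
| tcong_bal r v w : tcong [:: (actr r v, w)] [:: (v, actl r w)].

Definition tcongb (s t : seq (V * W)) : bool := `[< tcong s t >].

Lemma tcongb_refl : reflexive tcongb.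
Proof. by move=> s; apply/asboolP; apply: tcong_refl. Qed.

Lemma tcongb_sym : symmetric tcongb.
Proof. by move=> s t; apply/asboolP/asboolP; apply: tcong_sym. Qed.

Lemma tcongb_trans : transitive tcongb.
Proof.
by move=> t s u /asboolP st /asboolP tu; apply/asboolP; apply: tcong_trans st tu.
Qed.

Canonical tcong_equiv := EquivRel tcongb tcongb_refl tcongb_sym tcongb_trans.

Definition btens : Type := {eq_quot tcong_equiv}.

HB.instance Definition _ := Choice.on btens.
HB.instance Definition _ := EqQuotient.on btens.

Lemma btensP (s t : seq (V * W)) : tcong s t <-> \pi_btens s = \pi_btens t.
Proof.
split; first by move=> st; apply/eqquotP; apply/asboolP.
by move/eqquotP/asboolP.
Qed.

Definition bt_scale_seq (a : K) (s : seq (V * W)) := [seq (a *: p.1, p.2) | p <- s].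

Definition bt_add (x y : btens) : btens := \pi_btens (repr x ++ repr y).
Definition bt_scale (a : K) (x : btens) : btens := \pi_btens (bt_scale_seq a (repr x)).

Lemma bt_repr s : tcong (repr (\pi_btens s)) s.
Proof. by apply/btensP; rewrite reprK. Qed.

Lemma bt_addE s t : bt_add (\pi_btens s) (\pi_btens t) = \pi_btens (s ++ t).
Proof. by apply/btensP; apply: tcong_cat; apply: bt_repr. Qed.

Lemma tcong_scale a s t : tcong s t -> tcong (bt_scale_seq a s) (bt_scale_seq a t).
Proof.
elim=> {s t}; rewrite /bt_scale_seq.
- by move=> s; apply: tcong_refl.
- by move=> s t _; apply: tcong_sym.
- by move=> s t u _ st _; apply: tcong_trans.
- by move=> s s' t t' _ ss' _ tt'; rewrite !map_cat; apply: tcong_cat.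
- by move=> s t; rewrite !map_cat; apply: tcong_comm.
- by move=> v w /=; rewrite scalerN; apply: tcong_opp.
- by move=> v v' w /=; rewrite scalerDr; apply: tcong_addl.
- by move=> v w w' /=; apply: tcong_addr.
- by move=> r v w /=; rewrite -linearZ; apply: tcong_bal.
Qed.

Lemma bt_scaleE a s : bt_scale a (\pi_btens s) = \pi_btens (bt_scale_seq a s).
Proof. by apply/btensP; apply: tcong_scale; apply: bt_repr. Qed.

Lemma bt_ind0 (Q : btens -> Prop) : (forall s, Q (\pi_btens s)) -> forall x, Q x.
Proof. by move=> h x; rewrite -[x]reprK. Qed.

Lemma bt_addA : associative bt_add.
Proof.
elim/bt_ind0=> s; elim/bt_ind0=> t; elim/bt_ind0=> u.
by rewrite !bt_addE catA.
Qed.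

Lemma bt_addC : commutative bt_add.
Proof.
elim/bt_ind0=> s; elim/bt_ind0=> t; rewrite !bt_addE.
by apply/btensP; apply: tcong_comm.
Qed.

Lemma bt_add0 : left_id (\pi_btens [::]) bt_add.
Proof. by elim/bt_ind0=> s; rewrite bt_addE. Qed.

Lemma bt_addN : left_inverse (\pi_btens [::]) (bt_scale (-1)) bt_add.
Proof.
elim/bt_ind0=> s; rewrite bt_addC bt_scaleE.
elim: s => [|[v w] s IHs] /=; first by rewrite bt_addE.
rewrite scaleN1r -cat1s -[(- v, w) :: _]cat1s -!bt_addE.
rewrite bt_addA -[bt_add (bt_add _ _) (\pi_btens [:: (- v, w)])]bt_addA.
rewrite (bt_addC (\pi_btens s)) bt_addA -bt_addA IHs bt_addC bt_add0 bt_addE.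
by apply/btensP; apply: tcong_opp.
Qed.

HB.instance Definition _ :=
  GRing.isZmodule.Build btens bt_addA bt_addC bt_add0 bt_addN.

Lemma bt_piD s t : \pi_btens (s ++ t) = \pi_btens s + \pi_btens t.
Proof. by rewrite -bt_addE. Qed.

Lemma bt_pi0 : \pi_btens [::] = 0.
Proof. by []. Qed.

Definition btpure (v : V) (w : W) : btens := \pi_btens [:: (v, w)].

Lemma bt_pi_sum s : \pi_btens s = \sum_(p <- s) btpure p.1 p.2.
Proof.
elim: s => [|[v w] s IHs]; first by rewrite big_nil.
by rewrite -cat1s bt_piD big_cons IHs.
Qed.

Lemma btpureDl v v' w : btpure (v + v') w = btpure v w + btpure v' w.
Proof. by rewrite -bt_piD; apply/btensP; apply: tcong_addl. Qed.

Lemma btpureDr v w w' : btpure v (w + w') = btpure v w + btpure v w'.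
Proof. by rewrite -bt_piD; apply/btensP; apply: tcong_addr. Qed.

Lemma btpure_bal r v w : btpure (actr r v) w = btpure v (actl r w).
Proof. by apply/btensP; apply: tcong_bal. Qed.

Lemma bt_scaleA a b x : bt_scale a (bt_scale b x) = bt_scale (a * b) x.
Proof.
elim/bt_ind0: x => s; rewrite !bt_scaleE /bt_scale_seq -map_comp.
by congr \pi; apply: eq_map => p /=; rewrite scalerA.
Qed.

Lemma bt_scale1 : left_id 1 bt_scale.
Proof.
elim/bt_ind0=> s; rewrite bt_scaleE; congr \pi.
by rewrite /bt_scale_seq -[RHS]map_id; apply: eq_map => -[v w] /=; rewrite scale1r.
Qed.

Lemma bt_scaleDr : right_distributive bt_scale +%R.
Proof.
move=> a; elim/bt_ind0=> s; elim/bt_ind0=> t.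
by rewrite -bt_piD !bt_scaleE -bt_piD /bt_scale_seq map_cat.
Qed.

Lemma bt_scaleDl x : {morph bt_scale^~ x : a b / a + b}.
Proof.
move=> a b; elim/bt_ind0: x => s; rewrite !bt_scaleE !bt_pi_sum !big_map.
by rewrite -big_split; apply: eq_bigr => p _ /=; rewrite scalerDl btpureDl.
Qed.

HB.instance Definition _ := GRing.Zmodule_isLmodule.Build K btens
  bt_scaleA bt_scale1 bt_scaleDr bt_scaleDl.

Lemma btpureZl a v w : btpure (a *: v) w = a *: btpure v w.
Proof. by rewrite -[RHS]/(bt_scale a _) bt_scaleE. Qed.

Lemma btens_ind (Q : btens -> Prop) :
  Q 0 -> (forall v w x, Q x -> Q (btpure v w + x)) -> forall x, Q x.
Proof.
move=> Q0 QS; elim/bt_ind0; elim=> [|[v w] s IHs]; first exact: Q0.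
by rewrite -cat1s bt_piD; apply: QS.
Qed.

(* The map v (x) w |-> g v w, computed on a chosen representative. It is
   independent of that choice when g is balanced, which is what btlift_pure
   and btliftD say. *)
Definition btlift (U : nmodType) (g : V -> W -> U) (x : btens) : U :=
  \sum_(p <- repr x) g p.1 p.2.

Definition balanced (U : nmodType) (g : V -> W -> U) : Prop :=
  [/\ forall v v' w, g (v + v') w = g v w + g v' w,
      forall v w w', g v (w + w') = g v w + g v w'
    & forall r v w, g (actr r v) w = g v (actl r w)].

Section Lift.
Variables (U : zmodType).
Implicit Type g : V -> W -> U.

Lemma balanced0l g w : balanced g -> g 0 w = 0.
Proof. by case=> gDl _ _; apply: (addrI (g 0 w)); rewrite -gDl !addr0. Qed.

Lemma btlift_pi g s : balanced g -> btlift g (\pi_btens s) = \sum_(p <- s) g p.1 p.2.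
Proof.
move=> gB; have [gDl gDr gA] := gB; rewrite /btlift.
suff cong s1 s2 : tcong s1 s2 ->
    \sum_(p <- s1) g p.1 p.2 = \sum_(p <- s2) g p.1 p.2 by exact/cong/bt_repr.
elim=> {s s1 s2}.
- by [].
- by move=> s t _ ->.
- by move=> s t u _ -> _ ->.
- by move=> s s' t t' _ es _ et; rewrite !big_cat /= es et.
- by move=> s t; rewrite !big_cat /= addrC.
- move=> v w; rewrite !big_cons !big_nil addr0 /= -gDl subrr.
  exact: balanced0l.
- by move=> v v' w; rewrite !big_cons !big_nil !addr0 /= gDl.
- by move=> v w w'; rewrite !big_cons !big_nil !addr0 /= gDr.
- by move=> r v w; rewrite !big_cons !big_nil !addr0 /= gA.
Qed.

Lemma btlift_pure g v w : balanced g -> btlift g (btpure v w) = g v w.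
Proof. by move=> gB; rewrite btlift_pi // big_seq1. Qed.

Lemma btliftD g : balanced g -> {morph btlift g : x y / x + y}.
Proof.
move=> gB; elim/bt_ind0=> s; elim/bt_ind0=> t.
by rewrite -bt_piD !btlift_pi // big_cat.
Qed.

Lemma btlift0 g : balanced g -> btlift g 0 = 0.
Proof. by move=> gB; rewrite -bt_pi0 btlift_pi // big_nil. Qed.

Lemma eq_btlift g g' : (forall v w, g v w = g' v w) -> btlift g =1 btlift g'.
Proof. by move=> eg x; apply: eq_bigr => p _. Qed.

Lemma btlift_addf g g' x :
  btlift (fun v w => g v w + g' v w) x = btlift g x + btlift g' x.
Proof. by rewrite /btlift big_split. Qed.

Lemma btlift_subf g g' x :
  btlift (fun v w => g v w - g' v w) x = btlift g x - btlift g' x.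
Proof. by rewrite /btlift sumrB. Qed.

Lemma btlift_0f x : btlift (fun _ _ => 0 : U) x = 0.
Proof. by rewrite /btlift big1. Qed.

End Lift.

Lemma btliftZ (U : lmodType K) (g : V -> W -> U) (gB : balanced g) :
  (forall a v w, g (a *: v) w = a *: g v w) ->
  forall a, {morph btlift g : x / a *: x}.
Proof.
move=> gZ a; elim/btens_ind => [|v w x IHx]; first by rewrite scaler0 btlift0 ?scaler0.
by rewrite scalerDr !btliftD // IHx -btpureZl !btlift_pure // gZ scalerDr.
Qed.

Lemma btens_ext (U : zmodType) (f g : btens -> U) :
  {morph f : x y / x + y} -> {morph g : x y / x + y} ->
  (forall v w, f (btpure v w) = g (btpure v w)) -> f =1 g.
Proof.
move=> fD gD fg; elim/btens_ind => [|v w x IHx]; last by rewrite fD gD fg IHx.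
have f0 : f 0 = 0 by apply: (addrI (f 0)); rewrite -fD !addr0.
have g0 : g 0 = 0 by apply: (addrI (g 0)); rewrite -gD !addr0.
by rewrite f0 g0.
Qed.

End BalancedTensor.

Section Tensor.
Variables (K : fieldType) (V W : lmodType K).

Definition tens : Type :=
  btens (fun c : K => GRing.scale c : {linear V -> V}) (fun (c : K) (w : W) => c *: w).

HB.instance Definition _ := GRing.Lmodule.on tens.

Definition tpure (v : V) (w : W) : tens := btpure _ _ v w.

Lemma tpureZr c v w : tpure v (c *: w) = c *: tpure v w.
Proof. by rewrite /tpure -btpure_bal btpureZl. Qed.

Definition tlift (U : nmodType) (g : V -> W -> U) (x : tens) : U := btlift g x.

End Tensor.

Arguments tens {K} (V W)%_type_scope.

Notation "V \ox W" := (tens V W) (at level 40, left associativity) : type_scope.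
Notation "v \ox w" := (tpure v w) (at level 40, left associativity) : ring_scope.

Section TensorTheory.
Variables (K : fieldType) (V W : lmodType K).

Definition bilin (U : lmodType K) (g : V -> W -> U) : Prop :=
  [/\ forall c v v' w, g (c *: v + v') w = c *: g v w + g v' w
    & forall c v w w', g v (c *: w + w') = c *: g v w + g v w'].

Lemma bilin_balanced (U : lmodType K) (g : V -> W -> U) : bilin g ->
  balanced (fun c : K => GRing.scale c : {linear V -> V}) (fun (c : K) w => c *: w) g.
Proof.
case=> gl gr.
have g0 w : g 0 w = 0.
  by have := gl (-1) 0 0 w; rewrite scaler0 addr0 scaleN1r addNr.
have g0' v : g v 0 = 0.
  by have := gr (-1) v 0 0; rewrite scaler0 addr0 scaleN1r addNr.
split=> [v v' w|v w w'|c v w] /=.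
- by have := gl 1 v v' w; rewrite !scale1r.
- by have := gr 1 v w w'; rewrite !scale1r.
- have := gl c v 0 w; have := gr c v w 0.
  by rewrite !addr0 g0 g0' !addr0 => -> ->.
Qed.

Lemma tlift_pure (U : lmodType K) (g : V -> W -> U) v w :
  bilin g -> tlift g (v \ox w) = g v w.
Proof. by move=> /bilin_balanced; apply: btlift_pure. Qed.

Lemma tlift_linear (U : lmodType K) (g : V -> W -> U) :
  bilin g -> linear (tlift g).
Proof.
move=> gB c x y; have gb := bilin_balanced gB; rewrite /tlift btliftD //.
rewrite btliftZ // => a v w; have [gl _] := gB.
by have := gl a v 0 w; rewrite !addr0 (balanced0l _ gb) addr0.
Qed.

Lemma tens_ext (U : lmodType K) (f g : V \ox W -> U) : linear f -> linear g ->
  (forall v w, f (v \ox w) = g (v \ox w)) -> f =1 g.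
Proof.
move=> fl gl; apply: btens_ext => x y.
  by have := fl 1 x y; rewrite !scale1r.
by have := gl 1 x y; rewrite !scale1r.
Qed.

Lemma tpure_bilin : bilin (@tpure K V W).
Proof.
split=> c v v' w; first by rewrite /tpure btpureDl btpureZl.
by rewrite /tpure btpureDr -/(tpure _ _) tpureZr.
Qed.

Lemma tpure_linl w : linear (fun v => @tpure K V W v w).
Proof. by case: tpure_bilin => hl hr c x y; rewrite ?hl ?hr. Qed.

Lemma tpure_linr v : linear (@tpure K V W v).
Proof. by case: tpure_bilin => hl hr c x y; rewrite ?hl ?hr. Qed.

End TensorTheory.

Lemma exists_linear_form (K : fieldType) (V : lmodType K) (v0 : V) : v0 != 0 ->
  exists f : V -> K, (forall c v w, f (c *: v + w) = c * f v + f w) /\ f v0 = 1.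
Proof.
move=> v0N0.
pose P (A : set V) := (forall c v w, A v -> A w -> A (c *: v + w)) /\ ~ A v0.
have [A [[Alin Av0] Amax]] : exists A, P A /\ forall B, (A `<` B)%classic -> ~ P B.
  apply: Zorn_bigcup => F FP Ftot; split; last by case=> X /FP[].
  move=> c v w [X FX Xv] [Y FY Yw].
  have [XY|YX] := Ftot _ _ FX FY.
    by exists Y => //; apply: (FP _ FY).1 => //; apply: XY.
  by exists X => //; apply: (FP _ FX).1 => //; apply: YX.
have A0 : A 0.
  apply: contrapT => NA0; apply: (Amax [set 0]%classic).
    split; last by move=> h; apply/NA0/(h 0).
    move=> v Av; suff : A (-1 *: v + v) by rewrite scaleN1r addNr => /NA0.
    exact: Alin.
  split=> [c v w /= -> ->|/= /eqP]; first by rewrite scaler0 addr0.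
  by apply/negP.
have AZ c v : A v -> A (c *: v) by move=> Av; rewrite -[c *: v]addr0; apply: Alin.
have AN v : A v -> A (- v) by rewrite -scaleN1r; apply: AZ.
have AD v w : A v -> A w -> A (v + w).
  by move=> Av Aw; rewrite -[v]scale1r; apply: Alin.
have dec v : exists c, A (v - c *: v0).
  have [Av|NAv] := pselect (A v); first by exists 0; rewrite scale0r subr0.
  pose B : set V := [set w | exists c, A (w - c *: v)]%classic.
  have NPB : ~ P B.
    apply: Amax; split; last first.
      by move=> h; apply/NAv/h; exists 1; rewrite scale1r subrr.
    by move=> w Aw; exists 0; rewrite scale0r subr0.
  have [d Ad] : B v0.
    apply: contrapT => NB; apply: NPB; split=> // c x y [a Aa] [b Ab].
    exists (c * a + b); have := Alin c _ _ Aa Ab.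
    by rewrite scalerBr scalerDl scalerA opprD addrACA.
  have dN0 : d != 0.
    by apply/eqP => d0; apply: Av0; move: Ad; rewrite d0 scale0r subr0.
  exists d^-1; have := AZ (- d^-1) _ Ad.
  by rewrite scalerBr scalerA mulNr mulVf // !scaleNr scale1r opprK addrC.
pose f v := projT1 (cid (dec v)).
have fP v : A (v - f v *: v0) by rewrite /f; case: cid.
have fU v c : A (v - c *: v0) -> c = f v.
  move=> Ac; apply/eqP; rewrite -subr_eq0; apply/negP => /negP dN0; apply: Av0.
  have := AD _ _ (fP v) (AN _ Ac).
  rewrite opprB addrC addrA subrK -scalerBl => /(AZ (c - f v)^-1).
  by rewrite scalerA mulVf // scale1r.
exists f; split=> [c v w|]; last first.
  by apply/esym/fU; rewrite scale1r subrr.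
apply/esym/fU; have := Alin c _ _ (fP v) (fP w).
by rewrite scalerBr scalerDl scalerA opprD addrACA.
Qed.

Section TensorAlgebra.
Variables (K : fieldType) (V W : algType K).
Implicit Types x y z : V \ox W.

(* (v (x) w) (v' (x) w') = v v' (x) w w' *)
Definition tmul x y : V \ox W :=
  tlift (fun v w => tlift (fun v' w' => (v * v') \ox (w * w')) y) x.

Let Ml (v : V) (w : W) : bilin (fun (v' : V) (w' : W) => (v * v') \ox (w * w')).
Proof.
have [bl br] := @tpure_bilin K V W.
split=> c a b d; first by rewrite mulrDr -scalerAr bl.
by rewrite mulrDr -scalerAr br.
Qed.

Let Mr y : bilin (fun (v : V) (w : W) => tlift (fun (v' : V) (w' : W) => (v * v') \ox (w * w')) y).
Proof.
have [bl br] := @tpure_bilin K V W.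
split=> c a b d; move: y.
  apply: tens_ext => [|e x y|v w]; first exact: tlift_linear.
    by rewrite !(tlift_linear (Ml _ _)) scalerDr !scalerA (mulrC c) -!scalerA addrACA scalerDr.
  by rewrite !tlift_pure // mulrDl -scalerAl bl.
apply: tens_ext => [|e x y|v w]; first exact: tlift_linear.
  by rewrite !(tlift_linear (Ml _ _)) scalerDr !scalerA (mulrC c) -!scalerA addrACA scalerDr.
by rewrite !tlift_pure // mulrDl -scalerAl br.
Qed.

Lemma tmul_pure v w v' w' : tmul (v \ox w) (v' \ox w') = (v * v') \ox (w * w').
Proof. by rewrite /tmul !tlift_pure. Qed.

Lemma tmul_linl y : linear (tmul^~ y).
Proof. exact: tlift_linear. Qed.

Lemma tmul_linr x : linear (tmul x).
Proof.
move=> c y z; move: x; apply: tens_ext; first exact: tlift_linear.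
  by move=> e a b; rewrite !tmul_linl scalerDr !scalerA (mulrC c) -!scalerA addrACA scalerDr.
by move=> v w; rewrite /tmul !tlift_pure // (tlift_linear (Ml _ _)).
Qed.

Let lin_comp (A B C : lmodType K) (f : B -> C) (g : A -> B) :
  linear f -> linear g -> linear (fun u : A => f (g u)).
Proof. by move=> fl gl c a b; rewrite gl fl. Qed.

Lemma tmulA : associative tmul.
Proof.
move=> + y z; apply: tens_ext.
- exact: tmul_linl.
- exact: lin_comp (tmul_linl _) (tmul_linl _).
move=> v w; move: y; apply: tens_ext.
- exact: lin_comp (tmul_linr _) (tmul_linl _).
- exact: lin_comp (tmul_linl _) (tmul_linr _).
move=> v' w'; move: z; apply: tens_ext.
- exact: lin_comp (tmul_linr _) (tmul_linr _).
- exact: tmul_linr.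
by move=> v'' w''; rewrite !tmul_pure !mulrA.
Qed.

Lemma tmul1l : left_id ((1 : V) \ox (1 : W)) tmul.
Proof.
apply: tens_ext; [exact: tmul_linr | by [] |].
by move=> v w; rewrite tmul_pure !mul1r.
Qed.

Lemma tmul1r : right_id ((1 : V) \ox (1 : W)) tmul.
Proof.
apply: tens_ext; [exact: tmul_linl | by [] |].
by move=> v w; rewrite tmul_pure !mulr1.
Qed.

Lemma tmulDl : left_distributive tmul +%R.
Proof. by move=> x y z; have := tmul_linl z 1 x y; rewrite !scale1r. Qed.

Lemma tmulDr : right_distributive tmul +%R.
Proof. by move=> x y z; have := tmul_linr x 1 y z; rewrite !scale1r. Qed.

HB.instance Definition _ := GRing.Zmodule_isPzRing.Build (V \ox W)%type
  tmulA tmul1l tmul1r tmulDl tmulDr.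

Lemma tens1_neq0 : (1 : V \ox W) != 0.
Proof.
have [f [fl f1]] := exists_linear_form (oner_neq0 V).
have [g [gl g1]] := exists_linear_form (oner_neq0 W).
have fgB : bilin (fun v w => f v * g w : K^o).
  split=> c a b d; first by rewrite fl mulrDl -mulrA.
  by rewrite gl mulrDr mulrCA.
apply/eqP => e; have := tlift_pure 1 1 fgB; rewrite -[(1 : V) \ox (1 : W)]/(1 : V \ox W) e.
rewrite f1 g1 mul1r /tlift btlift0; last exact: bilin_balanced.
by move/esym/eqP; rewrite oner_eq0.
Qed.

HB.instance Definition _ := GRing.PzSemiRing_isNonZero.Build (V \ox W)%type tens1_neq0.

Lemma tens_scalerAl (c : K) x y : c *: (x * y) = (c *: x) * y.
Proof.
have := tmul_linl y c x 0; rewrite addr0 -[tmul 0 y]/(0 * y) mul0r addr0.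
by move=> e; rewrite [RHS]e.
Qed.

HB.instance Definition _ := GRing.Lmodule_isLalgebra.Build K (V \ox W)%type tens_scalerAl.

Lemma tens_scalerAr (c : K) x y : c *: (x * y) = x * (c *: y).
Proof.
have := tmul_linr x c y 0; rewrite addr0 -[tmul x 0]/(x * 0) mulr0 addr0.
by move=> e; rewrite [RHS]e.
Qed.

HB.instance Definition _ := GRing.Lalgebra_isAlgebra.Build K (V \ox W)%type tens_scalerAr.

Lemma tmulE v w v' w' :
  (v \ox w) * (v' \ox w') = (v * v') \ox (w * w') :> V \ox W.
Proof. exact: tmul_pure. Qed.

Lemma tens1E : 1 = (1 : V) \ox (1 : W) :> V \ox W.
Proof. by []. Qed.

End TensorAlgebra.

Section TensorMaps.
Variable K : fieldType.

Definition tmap (V W V' W' : lmodType K) (f : V -> V') (g : W -> W')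
    (x : V \ox W) : V' \ox W' :=
  tlift (fun v w => f v \ox g w) x.

Definition tswap (V W : lmodType K) (x : V \ox W) : W \ox V :=
  tlift (fun v w => w \ox v) x.

Definition tassoc (U V W : lmodType K) (x : U \ox (V \ox W)) : (U \ox V) \ox W :=
  tlift (fun u y => tlift (fun v w => (u \ox v) \ox w) y) x.

Lemma linear_comp (A B C : lmodType K) (f : B -> C) (g : A -> B) :
  linear f -> linear g -> linear (fun u : A => f (g u)).
Proof. by move=> fl gl c a b; rewrite gl fl. Qed.

Section Tmap.
Variables (V W V' W' : lmodType K) (f : {linear V -> V'}) (g : {linear W -> W'}).

Lemma tmap_bilin : bilin (fun v w => f v \ox g w).
Proof.
have [bl br] := @tpure_bilin K V' W'.
by split=> c a b d; rewrite linearP ?bl ?br.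
Qed.

Lemma tmap_linear : linear (tmap f g).
Proof. exact/tlift_linear/tmap_bilin. Qed.

Lemma tmap_pure (v : V) (w : W) : tmap f g (v \ox w) = f v \ox g w.
Proof. exact/tlift_pure/tmap_bilin. Qed.

End Tmap.

Section Tassoc.
Variables (U V W : lmodType K).

Let Ai u : bilin (fun (v : V) (w : W) => ((u : U) \ox v) \ox w).
Proof.
have [bl br] := @tpure_bilin K (U \ox V)%type W.
have [bl' br'] := @tpure_bilin K U V.
by split=> c a b d; rewrite ?br' ?bl ?br.
Qed.

Let Ao : bilin (fun (u : U) (y : V \ox W) => tlift (fun v w => (u \ox v) \ox w) y).
Proof.
have [bl br] := @tpure_bilin K (U \ox V)%type W.
have [bl' br'] := @tpure_bilin K U V.
split=> c a b d; last exact: (tlift_linear (Ai _)).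
move: d; apply: tens_ext => [|e x y|v w]; first exact: (tlift_linear (Ai _)).
  rewrite !(tlift_linear (Ai _)) scalerDr !scalerA (mulrC c) -!scalerA addrACA.
  by rewrite scalerDr.
by rewrite !(tlift_pure _ _ (Ai _)) bl' bl.
Qed.

Lemma tassoc_linear : linear (@tassoc U V W).
Proof. exact: tlift_linear Ao. Qed.

Lemma tassoc_pure (u : U) (v : V) (w : W) : tassoc (u \ox (v \ox w)) = (u \ox v) \ox w.
Proof. by rewrite /tassoc (tlift_pure _ _ Ao) (tlift_pure _ _ (Ai _)). Qed.

End Tassoc.

Lemma mul_linl (A : algType K) (x : A) : linear (fun y => y * x).
Proof. by move=> c a b; rewrite mulrDl scalerAl. Qed.

Lemma mul_linr (A : algType K) (x : A) : linear (fun y => x * y).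
Proof. by move=> c a b; rewrite mulrDr scalerAr. Qed.

Lemma tens3_ext (U V W B : lmodType K) (f g : U \ox (V \ox W) -> B) :
  linear f -> linear g ->
  (forall i : U * V * W, f (i.1.1 \ox (i.1.2 \ox i.2)) = g (i.1.1 \ox (i.1.2 \ox i.2))) ->
  f =1 g.
Proof.
move=> fl gl fg; apply: tens_ext => // u; apply: tens_ext => [c a b|c a b|v w].
- by rewrite tpure_linr fl.
- by rewrite tpure_linr gl.
- exact: (fg (u, v, w)).
Qed.

Lemma morphM_gen (A B : algType K) (I : Type) (gen : I -> A) (f : A -> B) : linear f ->
  (forall g h : A -> B, linear g -> linear h ->
    (forall i, g (gen i) = h (gen i)) -> g =1 h) ->
  (forall i j, f (gen i * gen j) = f (gen i) * f (gen j)) -> {morph f : x y / x * y}.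
Proof.
move=> fl ext fM x y; move: x; apply: (ext (fun x => f (x * y)) (fun x => f x * f y)) => [c a b|c a b|i].
- by rewrite mul_linl fl.
- by rewrite fl mul_linl.
move: y; apply: (ext (fun y => f (gen i * y)) (fun y => f (gen i) * f y)) => [c a b|c a b|j]; last exact: fM.
- by rewrite mul_linr fl.
- by rewrite fl mul_linr.
Qed.

Lemma tmapM (V W V' W' : algType K)
    (f : {lrmorphism V -> V'}) (g : {lrmorphism W -> W'}) (x y : V \ox W) :
  tmap f g (x * y) = tmap f g x * tmap f g y.
Proof.
move: x y; apply: (@morphM_gen _ _ _ (fun i : V * W => i.1 \ox i.2)).
- exact: tmap_linear.
- by move=> h h' hl hl' hh'; apply: tens_ext => // v w; apply: (hh' (v, w)).
by move=> i j; rewrite tmulE !tmap_pure tmulE !rmorphM.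
Qed.

Lemma tassocM (U V W : algType K) (x y : U \ox (V \ox W)) :
  tassoc (x * y) = tassoc x * tassoc y.
Proof.
move: x y; apply: (@morphM_gen _ _ _
  (fun i : U * V * W => i.1.1 \ox (i.1.2 \ox i.2))).
- exact: tassoc_linear.
- exact: tens3_ext.
by move=> i j; rewrite !tmulE !tassoc_pure !tmulE.
Qed.

End TensorMaps.

Record hopfAlgebra (k : fieldType) := HopfAlgebra {
  hopf_alg :> algType k;
  comul : {lrmorphism hopf_alg -> hopf_alg \ox hopf_alg};
  counit : {lrmorphism hopf_alg -> k^o};
  antipode : {linear hopf_alg -> hopf_alg};
  comulA : forall h, tmap comul idfun (comul h) =
                     tassoc (tmap idfun comul (comul h));
  counitl : forall h, tlift (fun x y => counit x *: y) (comul h) = h;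
  counitr : forall h, tlift (fun x y => counit y *: x) (comul h) = h;
  antipodel : forall h, tlift (fun x y => antipode x * y) (comul h) = (counit h)%:A;
  antipoder : forall h, tlift (fun x y => x * antipode y) (comul h) = (counit h)%:A
}.

Definition cocommutative (k : fieldType) (H : hopfAlgebra k) : Prop :=
  forall h : H, tswap (comul H h) = comul H h.

(* P (x)_H M, for an algebra P on which H acts on the right by multiplication
   through the algebra map d : H -> P (the iterated comultiplication, when
   P is a tensor power of H). *)

Section HTensor.
Variables (k : fieldType) (H P : algType k) (d : H -> P).

Definition hract (h : H) : {linear P -> P} := (d h) \o* (@idfun P).

Definition htens (M : lmodType H) : Type := btens hract (fun (h : H) (m : M) => h *: m).

HB.instance Definition _ (M : lmodType H) := GRing.Lmodule.on (htens M).

Section Theory.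
Variables (M N : lmodType H).

Definition hpure (F : P) (m : M) : htens M := btpure _ _ F m.

Definition hlift (U : nmodType) (g : P -> M -> U) (t : htens M) : U := btlift g t.

Definition hlact (F : P) (t : htens M) : htens M :=
  btlift (fun G m => hpure (F * G) m) t.

Definition hbalanced (U : nmodType) (g : P -> M -> U) : Prop :=
  [/\ forall F F' m, g (F + F') m = g F m + g F' m,
      forall F m m', g F (m + m') = g F m + g F m'
    & forall h F m, g (F * d h) m = g F (h *: m)].

Lemma hbalancedP (U : nmodType) (g : P -> M -> U) : hbalanced g ->
  balanced hract (fun (h : H) (m : M) => h *: m) g.
Proof. by []. Qed.

Lemma hpure_balanced : hbalanced hpure.
Proof.
split=> *; [exact: btpureDl | exact: btpureDr |].
by rewrite /hpure -btpure_bal.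
Qed.

Lemma hpureZ c F m : hpure (c *: F) m = c *: hpure F m.
Proof. exact: btpureZl. Qed.

Lemma hlift_pure (U : zmodType) (g : P -> M -> U) F m :
  hbalanced g -> hlift g (hpure F m) = g F m.
Proof. by move=> gB; apply: btlift_pure. Qed.

Lemma hliftD (U : zmodType) (g : P -> M -> U) : hbalanced g ->
  {morph hlift g : x y / x + y}.
Proof. by move=> gB; apply: btliftD. Qed.

Lemma htens_ext (U : zmodType) (f g : htens M -> U) :
  {morph f : x y / x + y} -> {morph g : x y / x + y} ->
  (forall F m, f (hpure F m) = g (hpure F m)) -> f =1 g.
Proof. exact: btens_ext. Qed.

Lemma hlact_balanced F : hbalanced (fun G m => hpure (F * G) m).
Proof.
have [bl br bb] := hpure_balanced; split=> [G G' m|G m m'|h G m].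
- by rewrite mulrDr bl.
- exact: br.
- by rewrite mulrA bb.
Qed.

Lemma hlact_pure F G m : hlact F (hpure G m) = hpure (F * G) m.
Proof. exact: (hlift_pure _ _ (hlact_balanced F)). Qed.

Lemma hlactDr F : {morph hlact F : x y / x + y}.
Proof. exact: (hliftD (hlact_balanced F)). Qed.

Lemma hlactDl F F' t : hlact (F + F') t = hlact F t + hlact F' t.
Proof.
move: t; apply: htens_ext => [x y|x y|G m].
- exact: hlactDr.
- by rewrite !hlactDr addrACA.
- by rewrite !hlact_pure mulrDl; case: hpure_balanced => ->.
Qed.

Lemma hlactM F F' t : hlact (F * F') t = hlact F (hlact F' t).
Proof.
move: t; apply: htens_ext => [x y|x y|G m]; rewrite ?hlactDr //.
by rewrite !hlact_pure mulrA.
Qed.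

Lemma hlactZ (c : k) t : hlact c%:A t = c *: t.
Proof.
move: t; apply: htens_ext => [x y|x y|G m]; rewrite ?hlactDr ?scalerDr //.
by rewrite hlact_pure mulr_algl hpureZ.
Qed.

End Theory.

(* id (x)_H phi *)
Definition hmap (M N : lmodType H) (phi : {linear M -> N}) (t : htens M) : htens N :=
  hlift (fun F m => hpure F (phi m)) t.

Lemma hmap_balanced (M N : lmodType H) (phi : {linear M -> N}) :
  hbalanced (fun F m => hpure F (phi m)).
Proof.
have [bl br bb] := hpure_balanced N; split=> [F F' m|F m m'|h F m].
- exact: bl.
- by rewrite linearD br.
- by rewrite linearZ bb.
Qed.

Lemma hmap_pure (M N : lmodType H) (phi : {linear M -> N}) F m :
  hmap phi (hpure F m) = hpure F (phi m).
Proof. exact: (hlift_pure _ _ (hmap_balanced phi)). Qed.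

Lemma hmapD (M N : lmodType H) (phi : {linear M -> N}) :
  {morph hmap phi : x y / x + y}.
Proof. exact: (hliftD (hmap_balanced phi)). Qed.

Lemma hmap_hlact (M N : lmodType H) (phi : {linear M -> N}) F t :
  hmap phi (hlact F t) = hlact F (hmap phi t).
Proof.
move: t; apply: htens_ext => [x y|x y|G m]; rewrite ?hlactDr ?hmapD ?hlactDr //.
by rewrite hlact_pure !hmap_pure hlact_pure.
Qed.

End HTensor.

Section Pseudo.
Variables (k : fieldType) (H : hopfAlgebra k).
Implicit Types L M N : lmodType H.

Definition comul3 (h : H) : (H \ox H) \ox H := tmap (comul H) idfun (comul H h).

Definition H2tens M : Type := htens (comul H) M.
Definition H3tens M : Type := htens comul3 M.

HB.instance Definition _ M := GRing.Lmodule.on (H2tens M).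
HB.instance Definition _ M := GRing.Lmodule.on (H3tens M).

(* Maps L (x) M -> H^{(x)2} (x)_H N are given as functions of two arguments.
   k-bilinearity is the case f, g in k1 of the last clause, see H2linearZl. *)
Definition H2linear L M N (mu : L -> M -> H2tens N) : Prop :=
  [/\ forall a a' b, mu (a + a') b = mu a b + mu a' b,
      forall a b b', mu a (b + b') = mu a b + mu a b'
    & forall (f g : H) a b, mu (f *: a) (g *: b) = hlact (f \ox g) (mu a b)].

(* mu(F (x)_H x, y), extended additively to H^{(x)2} (x)_H L in the first argument:
   F (x)_H x |-> sum_i (F (x) 1) (Delta (x) id)(G_i) (x)_H e_i
   where mu(x, y) = sum_i G_i (x)_H e_i. *)
Definition compl L M N (mu : L -> M -> H2tens N) (t : H2tens L) (y : M) : H3tens N :=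
  hlift (fun F x =>
    hlift (fun G e => hpure comul3 ((F \ox 1) * tmap (comul H) idfun G) e) (mu x y)) t.

(* mu(x, F (x)_H y), extended additively:
   F (x)_H y |-> sum_i (1 (x) F) (id (x) Delta)(G_i) (x)_H e_i,
   with H (x) (H (x) H) identified with (H (x) H) (x) H. *)
Definition compr L M N (mu : L -> M -> H2tens N) (x : L) (t : H2tens M) : H3tens N :=
  hlift (fun F y =>
    hlift (fun G e => hpure comul3 (tassoc ((1 \ox F) * tmap idfun (comul H) G)) e)
      (mu x y)) t.

Section Linear.
Variables (L M N : lmodType H) (mu : L -> M -> H2tens N).
Hypothesis muH : H2linear mu.

Lemma H2linearZl (c : k) a b : mu (c%:A *: a) b = c *: mu a b.
Proof.
have [_ _ h] := muH; rewrite -[X in mu _ X]scale1r h.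
have -> : (c%:A : H) \ox (1 : H) = c%:A :> H \ox H by rewrite /tpure btpureZl.
by rewrite hlactZ.
Qed.

Lemma H2linearZr (c : k) a b : mu a (c%:A *: b) = c *: mu a b.
Proof.
have [_ _ h] := muH; rewrite -[X in mu X _]scale1r h.
have -> : (1 : H) \ox (c%:A : H) = c%:A :> H \ox H by rewrite tpureZr.
by rewrite hlactZ.
Qed.

Let tl := tmap_linear (comul H) (@idfun H).
Let tr := tmap_linear (@idfun H) (comul H).

Let linD (V W : lmodType k) (f : V -> W) : linear f -> {morph f : x y / x + y}.
Proof. by move=> fl x y; have := fl 1 x y; rewrite !scale1r. Qed.

Lemma compl_inner F :
  hbalanced (comul H) (fun G (e : N) => hpure comul3 ((F \ox 1) * tmap (comul H) idfun G) e).
Proof.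
have [bl br bb] := @hpure_balanced _ _ _ comul3 N; split=> [G G' e|G e e'|h G e].
- by rewrite (linD tl) mulrDr bl.
- exact: br.
- by rewrite tmapM mulrA bb.
Qed.

Lemma compr_inner F :
  hbalanced (comul H) (fun G (e : N) =>
    hpure comul3 (tassoc ((1 \ox F) * tmap idfun (comul H) G)) e).
Proof.
have [bl br bb] := @hpure_balanced _ _ _ comul3 N; split=> [G G' e|G e e'|h G e].
- by rewrite (linD tr) mulrDr (linD (@tassoc_linear _ _ _ _)) bl.
- exact: br.
- by rewrite tmapM mulrA tassocM -comulA bb.
Qed.

Lemma compl_outer y :
  hbalanced (comul H) (fun F x =>
    hlift (fun G e => hpure comul3 ((F \ox 1) * tmap (comul H) idfun G) e) (mu x y)).
Proof.
have [bl br bb] := @hpure_balanced _ _ _ comul3 N; have [ml mr mh] := muH.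
split=> [F F' x|F x x'|h F x].
- move: (mu x y); apply: htens_ext => [u v|u v|G e].
  + exact: (hliftD (compl_inner _)).
  + by rewrite !(hliftD (compl_inner _)) addrACA.
  + rewrite !(hlift_pure _ _ (compl_inner _)) -bl -mulrDl.
    by rewrite /tpure btpureDl.
- by rewrite ml (hliftD (compl_inner _)).
- have -> : mu (h *: x) y = hlact (h \ox 1) (mu x y) by rewrite -mh scale1r.
  move: (mu x y); apply: htens_ext => [u v|u v|G e].
  + exact: (hliftD (compl_inner _)).
  + by rewrite hlactDr (hliftD (compl_inner _)).
  + rewrite hlact_pure !(hlift_pure _ _ (compl_inner _)) tmapM tmap_pure mulrA tmulE.
    by rewrite mulr1.
Qed.

Lemma compr_outer x :
  hbalanced (comul H) (fun F y =>
    hlift (fun G e => hpure comul3 (tassoc ((1 \ox F) * tmap idfun (comul H) G)) e)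
      (mu x y)).
Proof.
have [bl br bb] := @hpure_balanced _ _ _ comul3 N; have [ml mr mh] := muH.
split=> [F F' y|F y y'|h F y].
- move: (mu x y); apply: htens_ext => [u v|u v|G e].
  + exact: (hliftD (compr_inner _)).
  + by rewrite !(hliftD (compr_inner _)) addrACA.
  + rewrite !(hlift_pure _ _ (compr_inner _)) -bl.
    rewrite -(linD (@tassoc_linear _ _ _ _)) -mulrDl.
    by rewrite /tpure btpureDr.
- by rewrite mr (hliftD (compr_inner _)).
- have -> : mu x (h *: y) = hlact (1 \ox h) (mu x y) by rewrite -mh scale1r.
  move: (mu x y); apply: htens_ext => [u v|u v|G e].
  + exact: (hliftD (compr_inner _)).
  + by rewrite hlactDr (hliftD (compr_inner _)).
  + rewrite hlact_pure !(hlift_pure _ _ (compr_inner _)) tmapM tmap_pure mulrA tmulE.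
    by rewrite mulr1.
Qed.

Lemma compl_pure F x y :
  compl mu (hpure _ F x) y =
  hlift (fun G e => hpure comul3 ((F \ox 1) * tmap (comul H) idfun G) e) (mu x y).
Proof. exact: (hlift_pure _ _ (compl_outer y)). Qed.

Lemma compr_pure F x y :
  compr mu x (hpure _ F y) =
  hlift (fun G e => hpure comul3 (tassoc ((1 \ox F) * tmap idfun (comul H) G)) e)
    (mu x y).
Proof. exact: (hlift_pure _ _ (compr_outer x)). Qed.

Lemma complD y : {morph compl mu ^~ y : t u / t + u}.
Proof. exact: (hliftD (compl_outer y)). Qed.

Lemma comprD x : {morph compr mu x : t u / t + u}.
Proof. exact: (hliftD (compr_outer x)). Qed.

End Linear.

Lemma complDf L M N (mu nu : L -> M -> H2tens N) t y :
  compl (fun a b => mu a b + nu a b) t y = compl mu t y + compl nu t y.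
Proof.
rewrite /compl /hlift -btlift_addf; apply: eq_btlift => F x.
exact: (hliftD (compl_inner _ F)).
Qed.

Lemma comprDf L M N (mu nu : L -> M -> H2tens N) x t :
  compr (fun a b => mu a b + nu a b) x t = compr mu x t + compr nu x t.
Proof.
rewrite /compr /hlift -btlift_addf; apply: eq_btlift => F y.
exact: (hliftD (compr_inner _ F)).
Qed.

End Pseudo.

Record omegaPseudoalgebra (k : fieldType) (H : hopfAlgebra k) (Omega : semigroupType)
    (A : lmodType H) := OmegaPseudoalgebra {
  pprod :> Omega -> Omega -> A -> A -> H2tens A;
  pprod_linear : forall al be, H2linear (pprod al be);
  pprodA : forall al be ga a b c,
    compl (pprod (al * be)%g ga) (pprod al be a b) c =
    compr (pprod al (be * ga)%g) a (pprod be ga b c)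
}.

Section Cohomology.
Variables (k : fieldType) (H : hopfAlgebra k) (Omega : semigroupType).
Variables (A : lmodType H) (P : omegaPseudoalgebra Omega A).

(* H-linear maps A -> H (x)_H A = A. *)
Definition cochain1 : Type := Omega -> {linear A -> A}.

(* Families of maps, a group under pointwise addition; the 2-cochains are those
   satisfying is_cochain2. *)
Definition family2 : Type := Omega -> Omega -> A -> A -> H2tens A.

HB.instance Definition _ := GRing.Zmodule.on family2.

Definition is_cochain2 (f : family2) : Prop := forall al be, H2linear (f al be).

Definition d1 (phi : cochain1) : family2 := fun al be a b =>
  P al be a (phi be b) - hmap (phi (al * be)%g) (P al be a b) + P al be (phi al a) b.

Definition d2 (f : family2) (al be ga : Omega) (a b c : A) : H3tens A :=
  compr (P al (be * ga)%g) a (f be ga b c)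
  - compl (P (al * be)%g ga) (f al be a b) c
  - compl (f (al * be)%g ga) (P al be a b) c
  + compr (f al (be * ga)%g) a (P be ga b c).

Definition is_cocycle2 (f : family2) : Prop :=
  is_cochain2 f /\ forall al be ga a b c, d2 f al be ga a b c = 0.

Definition is_coboundary2 (f : family2) : Prop :=
  exists phi : cochain1, f = d1 phi.

Lemma family2B (f g : family2) al be a b : (f - g) al be a b = f al be a b - g al be a b.
Proof. by []. Qed.

Lemma H2linearB (L M N : lmodType H) (mu nu : L -> M -> H2tens N) :
  H2linear mu -> H2linear nu -> H2linear (fun a b => mu a b - nu a b).
Proof.
case=> ml mr mh [nl nr nh]; split=> [a a' b|a b b'|f g a b].
- by rewrite ml nl opprD addrACA.
- by rewrite mr nr opprD addrACA.
- rewrite mh nh; apply: (addIr (hlact (f \ox g) (nu a b))).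
  by rewrite subrK -(hlactDr (f \ox g) (_ - _)) subrK.
Qed.

Lemma H2linear0 (L M N : lmodType H) : H2linear (fun (_ : L) (_ : M) => 0 : H2tens N).
Proof.
split=> [*|*|f g a b]; rewrite ?addr0 //.
by apply: (addrI (hlact (f \ox g) 0)); rewrite -(hlactDr (f \ox g) 0) !addr0.
Qed.

Lemma complB (L M N : lmodType H) (mu : L -> M -> H2tens N) (muH : H2linear mu) t u y :
  compl mu (t - u) y = compl mu t y - compl mu u y.
Proof. by apply: (addIr (compl mu u y)); rewrite -(complD muH) !subrK. Qed.

Lemma comprB (L M N : lmodType H) (mu : L -> M -> H2tens N) (muH : H2linear mu) x t u :
  compr mu x (t - u) = compr mu x t - compr mu x u.
Proof. by apply: (addIr (compr mu x u)); rewrite -(comprD muH) !subrK. Qed.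

Lemma complBf (L M N : lmodType H) (mu nu : L -> M -> H2tens N) t y :
  compl (fun a b => mu a b - nu a b) t y = compl mu t y - compl nu t y.
Proof.
apply: (addIr (compl nu t y)); rewrite -complDf subrK.
by congr compl; do 2!apply/funext=> ?; rewrite subrK.
Qed.

Lemma comprBf (L M N : lmodType H) (mu nu : L -> M -> H2tens N) x t :
  compr (fun a b => mu a b - nu a b) x t = compr mu x t - compr nu x t.
Proof.
apply: (addIr (compr nu x t)); rewrite -comprDf subrK.
by congr compr; do 2!apply/funext=> ?; rewrite subrK.
Qed.

Lemma hmapB (M N : lmodType H) (phi psi : {linear M -> N}) (t : H2tens M) :
  hmap (phi \- psi) t = hmap phi t - hmap psi t :> H2tens N.
Proof.
rewrite /hmap /hlift -btlift_subf; apply: eq_btlift => F m /=.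
apply: (addIr (hpure (comul H) F (psi m))); rewrite subrK.
by case: (@hpure_balanced _ _ _ (comul H) N) => _ <- _; rewrite subrK.
Qed.

Lemma d2B (f g : family2) al be ga a b c :
  d2 (f - g) al be ga a b c = d2 f al be ga a b c - d2 g al be ga a b c.
Proof.
rewrite /d2 !family2B complB ?comprB; try exact: pprod_linear.
rewrite complBf comprBf.
have gen (V : zmodType) (x1 x2 x3 x4 x5 x6 x7 x8 : V) :
    x1 - x2 - (x3 - x4) - (x5 - x6) + (x7 - x8) =
    x1 - x3 - x5 + x7 - (x2 - x4 - x6 + x8).
  rewrite [in RHS]opprD [RHS]addrACA; congr (_ + _).
  rewrite [in RHS]opprD [RHS]addrACA -[in RHS]opprD; congr (_ - _).
  by rewrite [in RHS]opprD [RHS]addrACA -[in RHS]opprD.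
exact: gen.
Qed.

Lemma d20 al be ga a b c : d2 0 al be ga a b c = 0.
Proof. by rewrite -(subrr (0 : family2)) d2B subrr. Qed.

Definition cocycle2 : {pred family2} := fun f => `[< is_cocycle2 f >].

Lemma cocycle2_zmod : zmod_closed cocycle2.
Proof.
split=> [|f g /asboolP[fH f0] /asboolP[gH g0]]; apply/asboolP; split.
- by move=> al be; apply: H2linear0.
- exact: d20.
- by move=> al be; apply: H2linearB.
- by move=> al be ga a b c; rewrite d2B f0 g0 subrr.
Qed.

HB.instance Definition _ := GRing.isZmodClosed.Build family2 cocycle2 cocycle2_zmod.

Record Z2 : Type := MkZ2 { Z2val :> family2; _ : Z2val \in cocycle2 }.

HB.instance Definition _ := [isSub for Z2val].
HB.instance Definition _ := [Choice of Z2 by <:].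
HB.instance Definition _ := [SubChoice_isSubZmodule of Z2 by <:].

Definition coboundary2 : {pred Z2} := fun f => `[< is_coboundary2 (val f) >].

Lemma d1B (phi psi : cochain1) al be a b :
  d1 (fun w => phi w \- psi w : {linear A -> A}) al be a b =
  d1 phi al be a b - d1 psi al be a b.
Proof.
rewrite /d1 hmapB /=; have [pl pr _] := pprod_linear P al be.
have plB x y z : P al be (x - y) z = P al be x z - P al be y z.
  by apply: (addIr (P al be y z)); rewrite -pl !subrK.
have prB x y z : P al be x (y - z) = P al be x y - P al be x z.
  by apply: (addIr (P al be x z)); rewrite -pr !subrK.
rewrite plB prB.
have gen (V : zmodType) (x1 x2 x3 x4 x5 x6 : V) :
    x1 - x2 - (x3 - x4) + (x5 - x6) = x1 - x3 + x5 - (x2 - x4 + x6).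
  rewrite [in RHS]opprD [RHS]addrACA; congr (_ + _).
  by rewrite [in RHS]opprD [RHS]addrACA -[in RHS]opprD.
exact: gen.
Qed.

Lemma coboundary2_zmod : zmod_closed coboundary2.
Proof.
split=> [|f g /asboolP[phi ef] /asboolP[psi eg]]; apply/asboolP.
  pose i : cochain1 := fun=> idfun.
  exists (fun w => i w \- i w).
  do 4!apply/funext=> ?.
  by rewrite d1B subrr.
exists (fun w => phi w \- psi w).
do 4!apply/funext=> ?.
by rewrite d1B -ef -eg.
Qed.

HB.instance Definition _ := GRing.isZmodClosed.Build Z2 coboundary2 coboundary2_zmod.

(* ker d2 / im d1, with im d1 taken inside the group Z2 of cocycles. *)
Definition cohomology2 : zmodType := Quotient.quot coboundary2.

Lemma cohomology2_eq0 : (forall c : cohomology2, c = 0) <->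
  (forall f, is_cocycle2 f -> is_coboundary2 f).
Proof.
split=> [h f fZ|h c].
  have fZb : f \in cocycle2 by apply/asboolP.
  have /eqP := h (\pi_(Quotient.quot coboundary2) (MkZ2 fZb)).
  have <- : \pi_(Quotient.quot coboundary2) 0 = 0 by rewrite piE.
  by rewrite -Quotient.idealrBE subr0 => /asboolP.
rewrite -[c]reprK; have <- : \pi_(Quotient.quot coboundary2) 0 = 0 by rewrite piE.
apply/eqP; rewrite -Quotient.idealrBE subr0; apply/asboolP/h.
by case: (repr c) => f fZ; apply/asboolP.
Qed.

(* A formal sum sum_i T_i t^i is the sequence of its coefficients. *)
Definition is_deformation (T : nat -> family2) : Prop :=
  [/\ forall i, is_cochain2 (T i),
      forall al be x y, T 0%N al be x y = P al be x y
    & forall s al be ga x y z,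
        \sum_(i < s.+1) compr (T i al (be * ga)%g) x (T (s - i)%N be ga y z) =
        \sum_(i < s.+1) compl (T i (al * be)%g ga) (T (s - i)%N al be x y) z].

(* The coefficients of t^s on both sides; on the right, T'_i is applied to
   phi_j x and phi_l y with i + j + l = s. *)
Definition equivalent_deformations (T T' : nat -> family2) : Prop :=
  exists phi : nat -> cochain1,
    (forall w x, phi 0%N w x = x) /\
    forall s al be x y,
      \sum_(i < s.+1) hmap (phi i (al * be)%g) (T (s - i)%N al be x y) =
      \sum_(i < s.+1) \sum_(j < (s - i).+1)
         T' i al be (phi j al x) (phi (s - i - j)%N be y).

Definition trivial_deformation : nat -> family2 :=
  fun i => if i is 0 then P : family2 else 0.

Definition rigid : Prop :=
  forall T, is_deformation T -> equivalent_deformations T trivial_deformation.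

End Cohomology.

(* Main.v *)
(* A power series Phi = id + phi_1 t + ... trivialises the deformation T when the
   defect D(x, y) = Phi(T(x, y)) - P(Phi x, Phi y) vanishes. Associativity of T
   and of P gives the exact identity
     P(Phi x, D(y, z)) + D(x, T(y, z)) = P(D(x, y), Phi z) + D(T(x, y), z),
   so the lowest nonzero coefficient of D is a 2-cocycle. If that cocycle is
   d1 psi, adding psi t^(n+1) to Phi kills it without touching lower orders, and
   Phi is obtained by iterating this correction. *)
Require Import Defs.
From HB Require Import structures.
From mathcomp Require Import all_boot all_order all_algebra.
From mathcomp Require Import boolp.

Import GRing.Theory.
Local Open Scope ring_scope.

Set Implicit Arguments.
Unset Strict Implicit.
Unset Printing Implicit Defensive.

(** * Reindexing of sums over two or three indices with fixed total *)

Section Convolution.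
Variable V : nmodType.

Lemma conv_rev (F : nat -> nat -> V) s :
  \sum_(i < s.+1) F i (s - i)%N = \sum_(i < s.+1) F (s - i)%N i.
Proof.
rewrite (reindex_inj rev_ord_inj); apply: eq_bigr => i _ /=.
by rewrite subSS subKn // -ltnS.
Qed.

(** Both sides run over all triples with total [s], grouped by the sum of the first two indices or
    by the first index alone. The induction splits off the triples whose first index is 0. *)
Lemma conv_assoc (F : nat -> nat -> nat -> V) s :
  \sum_(i < s.+1) \sum_(j < i.+1) F j (i - j)%N (s - i)%N =
  \sum_(i < s.+1) \sum_(j < (s - i).+1) F i j (s - i - j)%N.
Proof.
elim: s F => [|s IHs] F; first by rewrite !big_ord1.
rewrite [RHS]big_ord_recl subn0.
rewrite [X in _ = _ + X](eq_bigr (fun i : 'I_s.+1 =>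
  \sum_(j < (s - i).+1) F i.+1 j (s - i - j)%N)); last by move=> i _; rewrite lift0.
rewrite -(IHs (fun i => F i.+1)).
rewrite [LHS](eq_bigr (fun i : 'I_s.+2 => F 0%N i (s.+1 - i)%N
    + \sum_(j < i) F j.+1 (i - j.+1)%N (s.+1 - i)%N)); last first.
  by move=> i _; rewrite big_ord_recl subn0.
rewrite big_split /=; congr (_ + _).
by rewrite big_ord_recl big_ord0 add0r; apply: eq_bigr => i _; rewrite lift0.
Qed.

Lemma big_ord_last n (F : 'I_n.+1 -> V) : (forall i : 'I_n.+1, (i < n)%N -> F i = 0) ->
  \sum_(i < n.+1) F i = F ord_max.
Proof.
by move=> F0; rewrite big_ord_recr big1 /= ?add0r // => i _; apply: F0 => /=.
Qed.

End Convolution.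

(** * Compatibility of compositions with H-linear maps and finite sums *)

Section PseudoMaps.
Variables (k : fieldType) (H : hopfAlgebra k).
Implicit Types L M N : lmodType H.

Lemma hmap_id (P : algType k) (d : H -> P) M (t : htens d M) : hmap idfun t = t.
Proof.
move: t; apply: htens_ext => [x y|//|F m]; first exact: hmapD.
exact: hmap_pure.
Qed.

Lemma hmap0 (P : algType k) (d : H -> P) M N (phi : {linear M -> N}) :
  hmap phi (0 : htens d M) = 0 :> htens d N.
Proof. by apply: (addrI (hmap phi (0 : htens d M))); rewrite -hmapD !addr0. Qed.

Lemma hmap_sum (P : algType k) (d : H -> P) M N (phi : {linear M -> N})
    n (F : 'I_n -> htens d M) :
  hmap phi (\sum_(i < n) F i) = \sum_(i < n) hmap phi (F i) :> htens d N.
Proof. exact: (big_morph _ (@hmapD _ _ _ d _ _ phi) (hmap0 d phi)). Qed.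

Lemma hmapDf (P : algType k) (d : H -> P) M N (phi psi : {linear M -> N})
    (t : htens d M) :
  hmap (phi \+ psi) t = hmap phi t + hmap psi t.
Proof.
move: t; apply: htens_ext => [x y|x y|F m].
- exact: hmapD.
- by rewrite !hmapD addrACA.
- by rewrite !hmap_pure; case: (hpure_balanced d N) => _ ->.
Qed.

Lemma H2linear_sum L M N n (mu : 'I_n -> L -> M -> H2tens N) :
  (forall i, H2linear (mu i)) -> H2linear (fun a b => \sum_(i < n) mu i a b).
Proof.
move=> muH; split=> [a a' b|a b b'|f g a b].
- by rewrite -big_split; apply: eq_bigr => i _; have [->] := muH i.
- by rewrite -big_split; apply: eq_bigr => i _; have [_ ->] := muH i.
- have hl0 : hlact (f \ox g) 0 = 0 :> H2tens N.
    by apply: (addrI (hlact (f \ox g) 0)); rewrite -(hlactDr (f \ox g) 0) !addr0.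
  rewrite [RHS](big_morph _ (@hlactDr _ _ _ (comul H) N (f \ox g)) hl0).
  by apply: eq_bigr => i _; have [_ _ ->] := muH i.
Qed.

Lemma H2linear_hmap L M N N' (mu : L -> M -> H2tens N) (phi : {linear N -> N'}) :
  H2linear mu -> H2linear (fun a b => hmap phi (mu a b)).
Proof.
case=> ml mr mh; split=> [a a' b|a b b'|f g a b].
- by rewrite ml hmapD.
- by rewrite mr hmapD.
- by rewrite mh hmap_hlact.
Qed.

Lemma H2linear_comp L L' M M' N (mu : L -> M -> H2tens N)
    (phi : {linear L' -> L}) (psi : {linear M' -> M}) :
  H2linear mu -> H2linear (fun a b => mu (phi a) (psi b)).
Proof.
case=> ml mr mh; split=> [a a' b|a b b'|f g a b].
- by rewrite linearD ml.
- by rewrite linearD mr.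
- by rewrite !linearZ mh.
Qed.

Section Comp.
Variables (L M N : lmodType H) (mu : L -> M -> H2tens N).
Hypothesis muH : H2linear mu.

Lemma compl0 y : compl mu 0 y = 0.
Proof. by apply: (addrI (compl mu 0 y)); rewrite -(complD muH) !addr0. Qed.

Lemma compr0 x : compr mu x 0 = 0.
Proof. by apply: (addrI (compr mu x 0)); rewrite -(comprD muH) !addr0. Qed.

Lemma compl_sum n (F : 'I_n -> H2tens L) y :
  compl mu (\sum_(i < n) F i) y = \sum_(i < n) compl mu (F i) y.
Proof. exact: (big_morph _ (complD muH y) (compl0 y)). Qed.

Lemma compr_sum n (F : 'I_n -> H2tens M) x :
  compr mu x (\sum_(i < n) F i) = \sum_(i < n) compr mu x (F i).
Proof. exact: (big_morph _ (comprD muH x) (compr0 x)). Qed.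

(** Naturality in the inner argument: both sides are additive in [t], so pure tensors suffice. *)
Lemma compl_hmapr L' (phi : {linear L' -> L}) (t : H2tens L') y :
  compl mu (hmap phi t) y = compl (fun a b => mu (phi a) b) t y.
Proof.
have nuH : H2linear (fun a b => mu (phi a) b).
  exact: (H2linear_comp phi (idfun : {linear M -> M}) muH).
move: t; apply: htens_ext => [u v|u v|F x].
- by rewrite hmapD (complD muH).
- by rewrite (complD nuH).
- by rewrite hmap_pure (compl_pure muH) (compl_pure nuH).
Qed.

Lemma compr_hmapr M' (phi : {linear M' -> M}) x (t : H2tens M') :
  compr mu x (hmap phi t) = compr (fun a b => mu a (phi b)) x t.
Proof.
have nuH : H2linear (fun a b => mu a (phi b)).
  exact: (H2linear_comp (idfun : {linear L -> L}) phi muH).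
move: t; apply: htens_ext => [u v|u v|F y].
- by rewrite hmapD (comprD muH).
- by rewrite (comprD nuH).
- by rewrite hmap_pure (compr_pure muH) (compr_pure nuH).
Qed.

(** Composition changes only the tensor power of H in the values of [mu], while [phi] acts only on
    the module factor. The check reduces to pure tensors twice, first for [t] and then for
    [mu x y]. *)
Lemma compl_hmapl N' (phi : {linear N -> N'}) t y :
  compl (fun a b => hmap phi (mu a b)) t y = hmap phi (compl mu t y).
Proof.
have nuH := H2linear_hmap phi muH.
move: t; apply: htens_ext => [u v|u v|F x].
- exact: (complD nuH).
- by rewrite (complD muH) hmapD.
rewrite (compl_pure nuH) (compl_pure muH).
move: (mu x y); apply: htens_ext => [u v|u v|G e].
- by rewrite hmapD (hliftD (compl_inner _ _)).
- by rewrite (hliftD (compl_inner _ _)) hmapD.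
- by rewrite hmap_pure !(hlift_pure _ _ (compl_inner _ _)) hmap_pure.
Qed.

Lemma compr_hmapl N' (phi : {linear N -> N'}) x t :
  compr (fun a b => hmap phi (mu a b)) x t = hmap phi (compr mu x t).
Proof.
have nuH := H2linear_hmap phi muH.
move: t; apply: htens_ext => [u v|u v|F y].
- exact: (comprD nuH).
- by rewrite (comprD muH) hmapD.
rewrite (compr_pure nuH) (compr_pure muH).
move: (mu x y); apply: htens_ext => [u v|u v|G e].
- by rewrite hmapD (hliftD (compr_inner _ _)).
- by rewrite (hliftD (compr_inner _ _)) hmapD.
- by rewrite hmap_pure !(hlift_pure _ _ (compr_inner _ _)) hmap_pure.
Qed.

End Comp.

Lemma compl0f L M N t y : compl (fun (_ : L) (_ : M) => 0 : H2tens N) t y = 0.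
Proof.
rewrite -[RHS](subrr (compl (fun (_ : L) (_ : M) => 0 : H2tens N) t y)) -complBf.
by congr compl; do 2!apply/funext=> ?; rewrite subrr.
Qed.

Lemma compr0f L M N x t : compr (fun (_ : L) (_ : M) => 0 : H2tens N) x t = 0.
Proof.
rewrite -[RHS](subrr (compr (fun (_ : L) (_ : M) => 0 : H2tens N) x t)) -comprBf.
by congr compr; do 2!apply/funext=> ?; rewrite subrr.
Qed.

Lemma compl_sumf L M N n (mu : 'I_n -> L -> M -> H2tens N) t y :
  compl (fun a b => \sum_(i < n) mu i a b) t y = \sum_(i < n) compl (mu i) t y.
Proof.
elim: n mu => [|n IHn] mu.
  rewrite big_ord0 -[RHS](compl0f (L := L) (M := M) N t y).
  by congr compl; do 2!apply/funext=> ?; rewrite big_ord0.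
rewrite big_ord_recl -(IHn (fun i => mu (lift ord0 i))) -complDf.
by congr compl; do 2!apply/funext=> ?; rewrite big_ord_recl.
Qed.

Lemma compr_sumf L M N n (mu : 'I_n -> L -> M -> H2tens N) x t :
  compr (fun a b => \sum_(i < n) mu i a b) x t = \sum_(i < n) compr (mu i) x t.
Proof.
elim: n mu => [|n IHn] mu.
  rewrite big_ord0 -[RHS](compr0f (L := L) (M := M) N x t).
  by congr compr; do 2!apply/funext=> ?; rewrite big_ord0.
rewrite big_ord_recl -(IHn (fun i => mu (lift ord0 i))) -comprDf.
by congr compr; do 2!apply/funext=> ?; rewrite big_ord_recl.
Qed.

End PseudoMaps.

(** * The defect of a power series and its lowest-order coefficient *)

Section Defect.
Variables (k : fieldType) (H : hopfAlgebra k) (Omega : semigroupType).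
Variables (A : lmodType H) (P : omegaPseudoalgebra Omega A).
Variables (T : nat -> family2 Omega A) (TP : is_deformation P T).
Implicit Type phi : nat -> cochain1 Omega A.

(** The coefficient of t^s in Phi(T(x, y)) - P(Phi x, Phi y). *)
Definition defect phi (s : nat) : family2 Omega A := fun al be x y =>
  \sum_(i < s.+1) hmap (phi i (al * be)%g) (T (s - i)%N al be x y) -
  \sum_(i < s.+1) P al be (phi i al x) (phi (s - i)%N be y).

Let PH := pprod_linear P.
Let TH : forall i, is_cochain2 (T i). Proof. by case: TP. Qed.

Lemma T0E al be : T 0%N al be = P al be.
Proof. by case: TP => _ T0 _; do 2!apply/funext=> ?; rewrite T0. Qed.

Lemma defect_linear phi s : is_cochain2 (defect phi s).
Proof.
move=> al be; apply: H2linearB; apply: H2linear_sum => i.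
  exact/H2linear_hmap/TH.
exact/H2linear_comp/PH.
Qed.

(** Phi is pulled out of the T-terms and pushed onto [t] in the P-terms; in this shape the mixed
    terms of the cocycle identity cancel. *)
Lemma compr_defect phi s al be x t :
  compr (defect phi s al be) x t =
  \sum_(i < s.+1) hmap (phi i (al * be)%g) (compr (T (s - i)%N al be) x t) -
  \sum_(i < s.+1) compr (P al be) (phi i al x) (hmap (phi (s - i)%N be) t).
Proof.
rewrite /defect comprBf !compr_sumf; congr (_ - _); apply: eq_bigr => i _.
  exact/compr_hmapl/TH.
by rewrite (compr_hmapr (PH _ _)).
Qed.

Lemma compl_defect phi s al be t y :
  compl (defect phi s al be) t y =
  \sum_(i < s.+1) hmap (phi i (al * be)%g) (compl (T (s - i)%N al be) t y) -
  \sum_(i < s.+1) compl (P al be) (hmap (phi i al) t) (phi (s - i)%N be y).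
Proof.
rewrite /defect complBf !compl_sumf; congr (_ - _); apply: eq_bigr => i _.
  exact/compl_hmapl/TH.
by rewrite (compl_hmapr (PH _ _)).
Qed.

(* Both sides are the coefficient of t^s in
   Phi(T(x, T(y, z))) - P(Phi x, P(Phi y, Phi z)). *)
Lemma defect_cocycle_series phi s al be ga x y z :
  \sum_(i < s.+1) compr (P al (be * ga)%g) (phi i al x) (defect phi (s - i) be ga y z)
  + \sum_(i < s.+1) compr (defect phi i al (be * ga)%g) x (T (s - i)%N be ga y z) =
  \sum_(i < s.+1) compl (P (al * be)%g ga) (defect phi i al be x y) (phi (s - i)%N ga z)
  + \sum_(i < s.+1) compl (defect phi i (al * be)%g ga) (T (s - i)%N al be x y) z.
Proof.
(* The series are P(Phi x, Phi(T(y, z))) for [a1], P(Phi x, P(Phi y, Phi z)) for [a2] and Phi(T(x,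
   T(y, z))) for [a3]; [b1] and [b3] are the left-bracketed mirrors of [a1] and [a3]. The mirror of
   [a2] equals [a2] by associativity of P. *)
pose a1 i j l := compr (P al (be * ga)%g) (phi i al x)
  (hmap (phi j (be * ga)%g) (T l be ga y z)).
pose a2 i j l := compr (P al (be * ga)%g) (phi i al x)
  (P be ga (phi j be y) (phi l ga z)).
pose a3 i j l := hmap (phi i (al * (be * ga))%g)
  (compr (T j al (be * ga)%g) x (T l be ga y z)).
pose b1 i j l := compl (P (al * be)%g ga)
  (hmap (phi i (al * be)%g) (T j al be x y)) (phi l ga z).
pose b3 i j l := hmap (phi i (al * be * ga)%g)
  (compl (T j (al * be)%g ga) (T l al be x y) z).
pose S (F : nat -> nat -> nat -> H3tens A) :=
  \sum_(i < s.+1) \sum_(j < (s - i).+1) F i j (s - i - j)%N.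
have -> : \sum_(i < s.+1) compr (P al (be * ga)%g) (phi i al x)
    (defect phi (s - i) be ga y z) = S a1 - S a2.
  rewrite -sumrB; apply: eq_bigr => i _.
  by rewrite /defect (comprB (PH _ _)) !(compr_sum (PH _ _)).
have -> : \sum_(i < s.+1) compr (defect phi i al (be * ga)%g) x
    (T (s - i)%N be ga y z) = S a3 - S a1.
  rewrite /S -!conv_assoc -sumrB; apply: eq_bigr => i _.
  exact: compr_defect.
have -> : \sum_(i < s.+1) compl (P (al * be)%g ga) (defect phi i al be x y)
    (phi (s - i)%N ga z) = S b1 - S a2.
  rewrite /S -!conv_assoc -sumrB; apply: eq_bigr => i _.
  rewrite /defect (complB (PH _ _)) !(compl_sum (PH _ _)); congr (_ - _).
  by apply: eq_bigr => j _; apply: pprodA.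
have -> : \sum_(i < s.+1) compl (defect phi i (al * be)%g ga)
    (T (s - i)%N al be x y) z = S b3 - S b1.
  (* Grouping by the order of the defect yields [b1] with its last two indices exchanged; reversing
     the inner sum restores their order. *)
  transitivity (S b3 - S (fun i j l => b1 i l j)).
    rewrite /S -(conv_assoc b3) -(conv_assoc (fun i j l => b1 i l j)) -sumrB.
    by apply: eq_bigr => i _; apply: compl_defect.
  congr (_ - _); apply: eq_bigr => i _.
  by rewrite (conv_rev (fun j l => b1 i l j)).
(* Associativity of T at order [s - i], under [phi i], whose index in Omega agrees on both sides
   because Omega is associative. *)
have -> : S a3 = S b3.
  apply: eq_bigr => i _; rewrite -!hmap_sum mulgA; congr hmap.
  by case: TP => _ _ ->.
by rewrite addrC subrKA [RHS]addrC subrKA.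
Qed.

Lemma defect_cocycle phi n : (forall w x, phi 0%N w x = x) ->
  (forall s, (s <= n)%N -> defect phi s = 0) -> is_cocycle2 P (defect phi n.+1).
Proof.
move=> phi0 D0; split=> [|al be ga a b c]; first exact: defect_linear.
have := defect_cocycle_series phi n.+1 al be ga a b c.
(* Only the defect of order [n.+1] survives: at i = 0 in the first sum, where the defect has order
   [n.+1 - i], and at the last index in the other three. With [phi 0] the identity and [T 0] equal
   to P, these are the four terms of [d2]. *)
rewrite [X in X + _]big_ord_recl [X in _ + X = _]big_ord_last; last first.
  by move=> i ltin; rewrite (D0 i) // compr0f.
rewrite [X in _ = X + _]big_ord_last; last first.
  by move=> i ltin; rewrite (D0 i) // (compl0 (PH _ _)).
rewrite [X in _ = _ + X]big_ord_last; last first.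
  by move=> i ltin; rewrite (D0 i) // compl0f.
rewrite [X in _ + X + _]big1 => [|i _]; last first.
  by rewrite lift0 subSS (D0 _ (leq_subr _ _)) (compr0 (PH _ _)).
rewrite !subnn !T0E !phi0 addr0 subn0 /d2 => e.
by rewrite addrAC [X in X - _]addrAC e -addrA -opprD subrr.
Qed.

Lemma defect_prefix phi phi' s : (forall i, (i <= s)%N -> phi i = phi' i) ->
  defect phi s = defect phi' s.
Proof.
move=> ephi; do 4!apply/funext=> ?; rewrite /defect.
congr (_ - _); apply: eq_bigr => i _.
  by rewrite ephi // -ltnS.
by rewrite !ephi ?leq_subr // -ltnS.
Qed.

(** The new coefficient occurs once in the T-sum, next to [T 0], and at both ends of the P-sum, next
    to [phi' 0]. Since these partners are P and the identity, the three changes add up to minus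
    [d1 P psi]. *)
Lemma defect_last phi phi' n (psi : cochain1 Omega A) :
  (forall w x, phi 0%N w x = x) ->
  (forall i, (i <= n)%N -> phi' i = phi i) ->
  phi' n.+1 = (fun w => phi n.+1 w \+ psi w : {linear A -> A}) ->
  defect phi' n.+1 = defect phi n.+1 - d1 P psi.
Proof.
move=> phi0 ephi elast; apply/funext=> al; apply/funext=> be.
apply/funext=> x; apply/funext=> y.
rewrite family2B /defect /d1.
have -> : \sum_(i < n.+2) hmap (phi' i (al * be)%g) (T (n.+1 - i)%N al be x y) =
    \sum_(i < n.+2) hmap (phi i (al * be)%g) (T (n.+1 - i)%N al be x y)
    + hmap (psi (al * be)%g) (P al be x y).
  rewrite !(big_ord_recr n.+1) /= subnn T0E elast hmapDf addrA.
  by congr (_ + _ + _); apply: eq_bigr => i _; rewrite ephi // -ltnS.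
have -> : \sum_(i < n.+2) P al be (phi' i al x) (phi' (n.+1 - i)%N be y) =
    \sum_(i < n.+2) P al be (phi i al x) (phi (n.+1 - i)%N be y)
    + (P al be x (psi be y) + P al be (psi al x) y).
  have [Pl Pr _] := PH al be.
  rewrite !(big_ord_recl n.+1) !(big_ord_recr n) !lift0 /= !subn0 !subnn elast /=.
  rewrite (ephi 0%N) // !phi0 Pr Pl -!addrA; congr (_ + _).
  rewrite addrCA; congr (_ + _); last exact: addrCA.
  by apply: eq_bigr => i _; rewrite !ephi //; apply: leq_subr.
by rewrite opprD addrACA [X in _ - _ - X]addrAC opprB.
Qed.

Lemma defect_extend phi n :
  (forall f, is_cocycle2 P f -> is_coboundary2 P f) ->
  (forall w x, phi 0%N w x = x) -> (forall s, (s <= n)%N -> defect phi s = 0) ->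
  exists phi', (forall i, (i <= n)%N -> phi' i = phi i) /\
    (forall s, (s <= n.+1)%N -> defect phi' s = 0).
Proof.
move=> H20 phi0 D0; have [psi epsi] := H20 _ (defect_cocycle phi0 D0).
pose phi' i : cochain1 Omega A :=
  if i == n.+1 then fun w => phi n.+1 w \+ psi w : {linear A -> A} else phi i.
have ephi i : (i <= n)%N -> phi' i = phi i.
  by move=> lein; rewrite /phi' ltn_eqF.
exists phi'; split=> // s; rewrite leq_eqVlt => /predU1P[->|].
  by rewrite (defect_last phi0 ephi (psi := psi)) ?epsi ?subrr // /phi' eqxx.
rewrite ltnS => lesn; rewrite -(D0 s lesn); apply: defect_prefix => i leis.
exact/ephi/(leq_trans leis).
Qed.

End Defect.

(** * Iterated correction and passage to the limit series *)

Theorem theorem5p4 (k : closedFieldType) (char0 : [pchar k] =i pred0)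
    (H : hopfAlgebra k) (Hcoc : cocommutative H)
    (Omega : semigroupType) (OmegaC : forall al be : Omega, (al * be = be * al)%g)
    (A : lmodType H) (P : omegaPseudoalgebra Omega A) :
  (forall c : cohomology2 P, c = 0) -> rigid P.
Proof.
move=> /cohomology2_eq0 H20 T TP.
pose good n (phi : nat -> cochain1 Omega A) := (forall w x, phi 0%N w x = x) /\
  forall s, (s <= n)%N -> defect P T phi s = 0.
have [next nextP] : {next : nat -> (nat -> cochain1 Omega A) -> nat -> cochain1 Omega A |
    forall n phi, good n phi ->
      (forall i, (i <= n)%N -> next n phi i = phi i) /\ good n.+1 (next n phi)}.
  (* The implication sits under the existential so that choice gives a total function; [phi] is the
     default witness when [good n phi] fails. *)
  have ex n phi : exists phi', good n phi ->
      (forall i, (i <= n)%N -> phi' i = phi i) /\ good n.+1 phi'.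
    have [gphi|] := pselect (good n phi); last by exists phi.
    have [phi0 D0] := gphi; have [phi' [ephi D0']] := defect_extend TP H20 phi0 D0.
    by exists phi' => _; split=> //; split=> // w x; rewrite ephi.
  exists (fun n phi => projT1 (cid (ex n phi))) => n phi gphi.
  by case: cid => phi' /= /(_ gphi).
(* The starting series has the identity in every degree; [good 0] constrains only its degree 0. *)
pose G := nat_rect (fun=> nat -> cochain1 Omega A) (fun _ _ => idfun) next.
have G_good n : good n (G n).
  elim: n => [|n /nextP[]//]; split=> // s; rewrite leqn0 => /eqP->.
  do 4!apply/funext=> ?; rewrite /defect !big_ord1 hmap_id (T0E TP).
  exact: subrr.
have G_stable m n i : (i <= m <= n)%N -> G n i = G m i.
  case/andP=> leim /subnK <-; elim: (n - m)%N => // p IHp.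
  rewrite addSn -IHp; apply: (nextP _ _ (G_good _)).1.
  exact: leq_trans leim (leq_addl _ _).
(* Coefficient [i] is settled from stage [i] on, so the diagonal agrees with [G s] up to order [s]
   and has the same defect there. *)
exists (fun i => G i i); split=> [|s al be x y]; first exact: (G_good 0%N).1.
have /(congr1 (fun f : family2 Omega A => f al be x y)) := (G_good s).2 s (leqnn s).
rewrite -(@defect_prefix _ _ _ _ P T (fun i => G i i)); last first.
  by move=> i leis; rewrite (@G_stable i s) ?leqnn.
move=> /subr0_eq ->.
(* The trivial deformation vanishes in positive degree, so only i = 0 remains of the triple
   convolution. *)
rewrite [RHS]big_ord_recl [X in _ + X]big1 ?addr0 ?subn0 // => i _.
by rewrite big1.
Qed.
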